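(* Fix $\rho$ satisfying $H(\rho)+\rho<1$. There is a constant $C=C(\rho)>0$ such that for all $d\geq 2$, if $\chi$ is a uniformly chosen proper $3$-colouring of $Q_d$ (with colours $0,1,2$), then $$\mathbb{P}\left(\exists\, i\in\{0,1,2\}:\ \left|\frac{|\chi^{-1}(i)\cap\mathcal{E}|}{|\mathcal{E}|}-\frac{|\chi^{-1}(i)\cap\mathcal{O}|}{|\mathcal{O}|}\right|\leq\rho\right)\leq \exp_2\left\{-\frac{C2^d}{\sqrt{d}\,\log d}\right\}.$$
   Context: $\log=\log_2$, $\exp_2 x=2^x$, and $H(x)=-x\log x-(1-x)\log(1-x)$ is the binary entropy function on $[0,1]$ (with $0\log 0=0$). $Q_d$ is the $d$-dimensional hypercube: the graph on vertex set $\{0,1\}^d$ in which two strings are adjacent iff they differ on exactly one coordinate. $\mathcal{E}$ and $\mathcal{O}$ are the two partition classes of the bipartite graph $Q_d$ (the strings with an even, respectively odd, number of $1$'s). A proper $3$-colouring is a map $\chi:\{0,1\}^d\to\{0,1,2\}$ with $\chi(x)\neq\chi(y)$ for all adjacent $x,y$. *)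

(* Defs.v *)
From HB Require Import structures.
From mathcomp Require Import all_boot all_order all_algebra.
From mathcomp Require Import reals exp.

Set Implicit Arguments.
Unset Strict Implicit.
Unset Printing Implicit Defensive.

Import Order.TTheory GRing.Theory Num.Theory.
Local Open Scope ring_scope.

Definition log2 {R : realType} (x : R) : R := ln x / ln 2.

Definition exp2 {R : realType} (x : R) : R := 2 `^ x.

(* The convention 0 log 0 = 0 comes for free: [ln] is total and its value at 0
   is multiplied by 0. *)
Definition bin_entropy {R : realType} (x : R) : R :=
  - (x * log2 x) - (1 - x) * log2 (1 - x).

Definition cube (d : nat) := {ffun 'I_d -> bool}.

Definition cube_adj (d : nat) : rel (cube d) :=
  fun x y => #|[set i | x i != y i]| == 1%N.

Definition evens (d : nat) : {set cube d} :=
  [set x : cube d | ~~ odd #|[set i | x i]|].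

Definition odds (d : nat) : {set cube d} :=
  [set x : cube d | odd #|[set i | x i]|].

Definition colouring (d : nat) := {ffun cube d -> 'I_3}.

Definition proper_colourings (d : nat) : {set colouring d} :=
  [set chi : colouring d |
     [forall x, forall y, cube_adj x y ==> (chi x != chi y)]].

Definition colour_class (d : nat) (chi : colouring d) (i : 'I_3) :
    {set cube d} :=
  [set x | chi x == i].

(* |A :&: B| / |B|: the proportion of B lying in A, equivalently the
   probability that a uniformly chosen element of B lies in A. *)
Definition proportion {R : realType} (T : finType) (A B : {set T}) : R :=
  #|A :&: B|%:R / #|B|%:R.

Definition unif_prob {R : realType} (T : finType) (S : {set T})
    (E : pred T) : R :=
  proportion [set x | E x] S.

(* Main.v *)
Require Import Defs.
From HB Require Import structures.
From mathcomp Require Import all_boot all_order all_algebra.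
From mathcomp Require Import reals sequences exp.
From mathcomp Require Import zify ring lra.

Set Implicit Arguments.
Unset Strict Implicit.
Unset Printing Implicit Defensive.

Import Order.TTheory GRing.Theory Num.Theory.
Local Open Scope ring_scope.

(** Let n = 2^(d-1). There are at least 2^n proper colourings, obtained by fixing
one parity class in one colour. A Kleitman-Winston algorithm covers all the
colourings by exp(O(e n / sqrt d)) families, e arbitrarily small, such that in
each of them every undecided vertex has few undecided neighbours. An undecided
vertex has then a monochromatic decided neighbourhood, hence exactly two possible
colours. Double counting edges shows that such a family has at most 2^(n - c|S|)
members, where S is a set of vertices separating the cube into six phases (which
parity class is free, and which colour the other one has). By a Bobkov-type
isoperimetric inequality either |S| is at least of order n / sqrt d, or one phase
occupies almost all of the cube. In the latter case the colouring is unbalanced in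
the colour of the fixed class, and balance in one of the two other colours means
that it is used on a proportion at most rho + o(1) < 1/2 of the free class, which
by Chernoff's bound leaves an exponentially small proportion of the 2^n choices.
The entropy hypothesis enters through its consequence rho < 1/2. *)

(** * Flips, parity and edge counts in the cube *)

Definition flip d (i : 'I_d) (x : cube d) : cube d :=
  [ffun j => x j (+) (j == i)].

Lemma flipK d (i : 'I_d) : involutive (flip i).
Proof. by move=> x; apply/ffunP=> j; rewrite !ffunE addbK. Qed.

Lemma flip_inj d (i : 'I_d) : injective (flip i).
Proof. exact: inv_inj (flipK i). Qed.

Lemma flipC d (i j : 'I_d) x : flip i (flip j x) = flip j (flip i x).
Proof. by apply/ffunP=> k; rewrite !ffunE -!addbA [(k == j) (+) _]addbC. Qed.

Lemma cube_adj_flip d (i : 'I_d) x : cube_adj x (flip i x).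
Proof.
rewrite /cube_adj (_ : [set _ | _] = [set i]) ?cards1 //.
apply/setP=> j; rewrite !inE ffunE.
by case: (x j); case: (j == i).
Qed.

Lemma cube_adjP d (x y : cube d) : cube_adj x y -> exists i, y = flip i x.
Proof.
move=> /cards1P[i /setP xy]; exists i; apply/ffunP=> j; rewrite ffunE.
by have := xy j; rewrite !inE; case: (x j); case: (y j); case: (j == i).
Qed.

Definition parity d (x : cube d) := odd #|[set i | x i]|.

Lemma parity_flip d (i : 'I_d) x : parity (flip i x) = ~~ parity x.
Proof.
rewrite /parity (cardsD1 i) [in RHS](cardsD1 i) !inE ffunE eqxx addbT.
rewrite (_ : _ :\ i = [set j | x j] :\ i) => [|]; first by case: (x i); rewrite ?negbK.
by apply/setP=> j; rewrite !inE ffunE; case: eqVneq; rewrite ?addbF.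
Qed.

Definition side d b : {set cube d} := [set x | parity x == b].

Lemma sideE d : (evens d = side d false) * (odds d = side d true).
Proof. by split; apply/setP=> x; rewrite !inE /parity; case: odd. Qed.

Lemma setC_side d b : ~: side d b = side d (~~ b).
Proof. by apply/setP=> x; rewrite !inE; case: b; case: parity. Qed.

Lemma card_cube d : #|{: cube d}| = (2 ^ d)%N.
Proof. by rewrite card_ffun card_bool card_ord. Qed.

Lemma card_side d b : #|side d.+1 b| = (2 ^ d)%N.
Proof.
have Ebn : #|side d.+1 b| = #|side d.+1 (~~ b)|.
  rewrite -(card_imset _ (@flip_inj _ ord0)); apply: eq_card => x.
  rewrite inE; apply/imsetP/eqP => [[y] | xb].
    by rewrite inE => /eqP yb ->; rewrite parity_flip yb.
  exists (flip ord0 x); last by rewrite flipK.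
  by rewrite inE parity_flip xb negbK.
have := cardsC (side d.+1 b); rewrite setC_side -Ebn card_cube expnS; lia.
Qed.

Definition dg d (A : {set cube d}) x : nat := (\sum_(i < d) (flip i x \in A))%N.

(** Edges with both ends in [A :&: B] count twice; in particular [ee U U] is twice the number of
    edges inside [U]. *)
Definition ee d (A B : {set cube d}) : nat := (\sum_(x in A) dg B x)%N.

Lemma dg_le d (A : {set cube d}) x : (dg A x <= d)%N.
Proof.
apply: (@leq_trans (\sum_(i < d) 1)%N); last by rewrite sum1_card card_ord.
by apply: leq_sum => i _; apply: leq_b1.
Qed.

Lemma dgS d (A B : {set cube d}) x : A \subset B -> (dg A x <= dg B x)%N.
Proof.
move=> /subsetP AB; apply: leq_sum => i _.
by case: (boolP (_ \in A)) => // /AB ->.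
Qed.

Lemma dgC d (A : {set cube d}) x : (dg A x + dg (~: A) x)%N = d.
Proof.
rewrite /dg -big_split /= -[RHS]card_ord -sum1_card; apply: eq_bigr => i _.
by rewrite inE; case: (_ \in A).
Qed.

Lemma eeC d (A B : {set cube d}) : ee A B = ee B A.
Proof.
have E (C D : {set cube d}) :
    ee C D = (\sum_(i < d) \sum_x (x \in C) * (flip i x \in D))%N.
  rewrite exchange_big /= /ee big_mkcond; apply: eq_bigr => x _.
  by case: (x \in C); [apply: eq_bigr => i _; rewrite mul1n | rewrite big1].
rewrite !E; apply: eq_bigr => i _.
rewrite (reindex_inj (@flip_inj _ i)) /=; apply: eq_bigr => x _.
by rewrite flipK mulnC.
Qed.

Lemma ee_total d (A : {set cube d}) : (ee A A + ee A (~: A) = d * #|A|)%N.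
Proof.
rewrite /ee -big_split /= mulnC -sum_nat_const; apply: eq_bigr => x _.
exact: dgC.
Qed.

(** Subtracting the degree sums of [U] and of its complement cancels the crossing edges. The size of
    [U] is thus controlled by the edges lying inside either of them. *)
Lemma ee_balance d (U : {set cube d}) :
  (2 * (d * #|U|) + ee (~: U) (~: U) = d * 2 ^ d + ee U U)%N.
Proof.
have := ee_total U; have := ee_total (~: U).
rewrite setCK (eeC (~: U) U).
have := cardsC U; rewrite card_cube => <-; nia.
Qed.

Lemma markov_card d (A B : {set cube d}) (a b : nat) :
  (forall x, x \in A -> (b <= a * dg B x)%N) -> (b * #|A| <= a * (d * #|B|))%N.
Proof.
move=> H; apply: (@leq_trans (a * ee A B)).
  rewrite /ee big_distrr /= mulnC -sum_nat_const; exact: leq_sum.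
rewrite leq_mul2l; apply/orP; right; rewrite eeC mulnC -sum_nat_const.
by apply: leq_sum => x _; apply: dg_le.
Qed.

(** * Counting colourings with two colours per vertex, using a matching *)

Lemma avoid_eq (a b c e : 'I_3) :
  e != c -> a != c -> b != c -> (a == e) = (b == e) -> a = b.
Proof.
move=> H1 H2 H3 H4; apply/eqP; move: H1 H2 H3 H4.
by case: a => [[|[|[|?]]] ?] //; case: b => [[|[|[|?]]] ?] //;
   case: c => [[|[|[|?]]] ?] //; case: e => [[|[|[|?]]] ?] //.
Qed.

Lemma avoid2_eq (a b c e : 'I_3) :
  c != e -> a != c -> a != e -> b != c -> b != e -> a = b.
Proof.
move=> ce ac ae bc be; apply: (@avoid_eq a b c e) => //; first by rewrite eq_sym.
by rewrite (negbTE ae) (negbTE be).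
Qed.

Lemma proper_flip d (chi : colouring d) i x :
  chi \in proper_colourings d -> chi x != chi (flip i x).
Proof.
by rewrite inE => /forallP/(_ x)/forallP/(_ (flip i x))/implyP -> //;
   apply: cube_adj_flip.
Qed.

Definition avoid_pairs (c1 c2 : 'I_3) : {set 'I_3 * 'I_3} :=
  [set p | [&& p.1 != c1, p.2 != c2 & p.1 != p.2]].

(** Two 2-subsets of a 3-set meet, so one of the four pairs allowed by the first two conditions is
    monochromatic. *)
Lemma card_avoid_pairs c1 c2 : (#|avoid_pairs c1 c2| <= 3)%N.
Proof.
have card2 (c : 'I_3) : #|[set~ c]| = 2%N by rewrite cardsC1 card_ord.
have cardX : #|setX [set~ c1] [set~ c2]| = 4%N by rewrite cardsX !card2.
rewrite -ltnS -cardX; apply: proper_card; apply/properP; split.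
  by apply/subsetP=> p; rewrite !inE => /and3P[-> ->].
have [c12|c12] := eqVneq c1 c2.
  subst c2; exists (c1 + 1, c1 + 1); rewrite !inE /= ?eqxx ?andbF //.
  by clear; case: c1 => [[|[|[|?]]] ?].
have [e e1 e2] : exists2 e : 'I_3, e != c1 & e != c2.
  (* The three colours sum to 0 in ['I_3], so this is the third one. *)
  exists (- (c1 + c2)); move: c12; clear;
  by case: c1 => [[|[|[|?]]] ?] //; case: c2 => [[|[|[|?]]] ?].
by exists (e, e); rewrite !inE /= ?eqxx ?andbF // e1 e2.
Qed.

(** A member of [F] is encoded by the set of vertices of [U] where it takes [c v + 1], one of the
    two colours left. *)
Lemma subset_count d (U : {set cube d}) (c : cube d -> 'I_3)
    (F : {set colouring d}) :
  (forall chi v, chi \in F -> v \in U -> chi v != c v) ->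
  (forall chi chi' v, chi \in F -> chi' \in F -> v \notin U ->
     chi v = chi' v) ->
  (#|F| <= 2 ^ #|U|)%N.
Proof.
move=> avoid agree; rewrite -card_powerset.
pose f (chi : colouring d) := [set v in U | chi v == c v + 1].
rewrite -(card_in_imset (f := f)) => [|chi chi' Fchi Fchi' ff].
  apply/subset_leq_card/subsetP=> _ /imsetP[chi _ ->].
  by rewrite powersetE; apply/subsetP=> v; rewrite inE => /andP[].
apply/ffunP=> v; case: (boolP (v \in U)) => Uv; last exact: agree.
apply: (@avoid_eq _ _ (c v) (c v + 1)); try exact: avoid.
  by case: (c v) => [[|[|[|?]]] ?].
by have /setP/(_ v) := ff; rewrite !inE Uv.
Qed.

(** [X] is the vertex set of a maximal matching of [m] edges inside [U], built greedily. Each of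
    these edges admits at most 3 of 4 pairs of colours, hence the bound 2^|U| (3/4)^m. [F] is
    quantified after [X] and [m], so that the induction hypothesis serves every piece of [F]. *)
Lemma list_count d (U : {set cube d}) :
  exists (X : {set cube d}) (m : nat),
  [/\ X \subset U, #|X| = m.*2,
      forall v i, v \in U -> flip i v \in U -> (v \in X) || (flip i v \in X) &
      forall (c : cube d -> 'I_3) (F : {set colouring d}),
      F \subset proper_colourings d ->
      (forall chi v, chi \in F -> v \in U -> chi v != c v) ->
      (forall chi chi' v, chi \in F -> chi' \in F -> v \notin U ->
         chi v = chi' v) ->
      (#|F| * 4 ^ m <= 2 ^ #|U| * 3 ^ m)%N].
Proof.
have [k] := ubnP #|U|; elim: k U => // k IH U ltUk.
case: (pickP (fun p : cube d * 'I_d => (p.1 \in U) && (flip p.2 p.1 \in U))).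
  move=> [v i] /= /andP[Uv Uw]; set w := flip i v in Uw.
  have vw : w != v.
    by apply/eqP=> /(congr1 (@parity d)); rewrite parity_flip; case: parity.
  pose U' := U :\ v :\ w.
  have cardU : #|U| = #|U'|.+2 by rewrite (cardsD1 v) Uv (cardsD1 w) !inE vw Uw.
  have [|X [m [XU' cardX coverX countX]]] := IH U'; first by lia.
  have notX x : x \in X -> (x != w) && (x != v).
    by move/(subsetP XU'); rewrite !inE => /and3P[-> ->].
  exists (v |: (w |: X)), m.+1; split.
  - apply/subsetP=> x; rewrite !inE => /or3P[/eqP->|/eqP->|/(subsetP XU')] //.
    by rewrite !inE => /and3P[].
  - have vX : v \notin X by apply/negP=> /notX; rewrite eqxx andbF.
    have wX : w \notin X by apply/negP=> /notX; rewrite eqxx.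
    by rewrite !cardsU1 !inE negb_or eq_sym vw vX wX cardX.
  - move=> x j Ux Uy; rewrite !inE.
    case: (boolP [|| x == v, x == w, flip j x == v | flip j x == w]).
      by case/or4P=> ->; rewrite ?orbT.
    rewrite !negb_or => /and4P[xv xw yv yw].
    have /orP[|] : (x \in X) || (flip j x \in X).
      by apply: coverX; rewrite !inE ?xv ?xw ?yv ?yw.
    by move=> ->; rewrite !orbT.
    by move=> ->; rewrite !orbT.
  move=> c F properF avoid agree.
  pose Fp p := [set chi in F | (chi v == p.1) && (chi w == p.2)].
  have leF : (#|F| <= \sum_(p in avoid_pairs (c v) (c w)) #|Fp p|)%N.
    rewrite (eq_bigr (fun p => \sum_(chi in F) (chi v == p.1) && (chi w == p.2)))%N.
      rewrite exchange_big /= -sum1_card; apply: leq_sum => chi Fchi.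
      rewrite (bigD1 (chi v, chi w)) /= ?eqxx ?leq_addr //.
      by rewrite inE /= !avoid //= proper_flip // (subsetP properF).
    move=> p _; rewrite -sum1_card [RHS]big_mkcond /= [LHS]big_mkcond /=.
    by apply: eq_bigr => chi _; rewrite inE; case: (chi \in F) => //=; case: ifP.
  have leFp p : (#|Fp p| * 4 ^ m <= 2 ^ #|U'| * 3 ^ m)%N.
    apply: (countX c).
    - by apply/subsetP=> chi; rewrite inE => /andP[/(subsetP properF)].
    - by move=> chi x; rewrite !inE => /andP[Fchi _] /and3P[_ _]; apply: avoid.
    move=> chi chi' x; rewrite !inE => /and3P[F1 /eqP v1 /eqP w1].
    move=> /and3P[F2 /eqP v2 /eqP w2].
    have [->|xw] /= := eqVneq x w; first by rewrite w1 w2.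
    have [->|xv] /= := eqVneq x v; first by rewrite v1 v2.
    exact: agree.
  have : (#|F| * 4 ^ m <= 3 * (2 ^ #|U'| * 3 ^ m))%N.
    apply: (leq_trans (leq_mul leF (leqnn _))); rewrite big_distrl /=.
    apply: (@leq_trans (\sum_(p in avoid_pairs (c v) (c w)) 2 ^ #|U'| * 3 ^ m)%N).
      by apply: leq_sum.
    by rewrite sum_nat_const leq_mul2r card_avoid_pairs orbT.
  rewrite cardU !expnS.
  move: #|F| (2 ^ _)%N (3 ^ _)%N (4 ^ _)%N => f a b e; clear=> H; nia.
move=> noedge; exists set0, 0%N; split; rewrite ?sub0set ?cards0 //.
  by move=> v i Uv Uw; have := noedge (v, i); rewrite /= Uv Uw.
by move=> c F _ avoid agree; rewrite !muln1; apply: subset_count avoid agree.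
Qed.

(** * Terminal families: separating the phases *)

Lemma eeSl d (A A' B : {set cube d}) : A \subset A' -> (ee A B <= ee A' B)%N.
Proof.
move=> /subsetP AA'; rewrite /ee [X in (X <= _)%N]big_mkcond [X in (_ <= X)%N]big_mkcond /=.
by apply: leq_sum => x _; case: (boolP (x \in A)) => // /AA' ->.
Qed.

Lemma ee_cover d (U X : {set cube d}) :
  (forall v i, v \in U -> flip i v \in U -> (v \in X) || (flip i v \in X)) ->
  X \subset U -> (ee U U <= 2 * ee X U)%N.
Proof.
move=> coverX /subsetP XU.
have -> : (2 * ee X U = ee X U + ee U X)%N by rewrite (eeC U) mul2n addnn.
rewrite /ee [X in (_ <= X + _)%N]big_mkcond [X in (_ <= _ + X)%N]big_mkcond /=.
rewrite [X in (X <= _)%N]big_mkcond -big_split /=; apply: leq_sum => x _.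
case: (boolP (x \in X)) => [/XU ->|Xx]; first exact: leq_addr.
case: (boolP (x \in U)) => // Ux; rewrite add0n; apply: leq_sum => i _.
case: (boolP (flip i x \in U)) => // Uy.
by have := coverX x i Ux Uy; rewrite (negbTE Xx) /= => ->.
Qed.

(** Every direction contributes at least 1. This is meant for adjacent [v] and [w]: their neighbours
    in a common direction are adjacent too, and [X] covers the edge joining them if it lies inside
    [U]. *)
Lemma dg_ge_union d (U X : {set cube d}) v w :
  (forall i, (flip i v \in U) && (flip i w \in U) ->
     (flip i v \in X) || (flip i w \in X)) ->
  (d <= dg (~: U) v + dg (~: U) w + (dg X v + dg X w))%N.
Proof.
move=> H; rewrite -[X in (X <= _)%N]card_ord -sum1_card /dg -!big_split /=.
apply: leq_sum => i _; have := H i; rewrite !inE.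
by case: (_ \in U); case: (_ \in U); case: (_ \in X); case: (_ \in X) => // /(_ isT).
Qed.

(* U is where the family F is not yet decided. A matching of size m inside U
   costs a factor (3/4)^m; its vertices X, together with the set X' of vertices
   with many neighbours in X and the set Z of decided vertices with many decided
   neighbours, separate the phases: an edge between decided vertices outside Z
   is parallel to at least 3d/4 edges inside U, each of which meets X. In the
   phase (p v, c v), the vertices of parity p v are free to take the two colours
   other than c v, and all the others have colour c v. *)
Lemma terminal_structure d (F : {set colouring d}) (chi0 : colouring d)
    (U := [set v | [exists chi in F, chi v != chi0 v]]) :
  (0 < d)%N -> F \subset proper_colourings d -> chi0 \in F ->
  (forall v, v \in U -> (24 * dg U v <= d)%N) ->
  exists (S : {set cube d}) (c : cube d -> 'I_3) (p : cube d -> bool)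
    (u m : nat),
  [/\ forall v i, v \notin S -> flip i v \notin S ->
        p (flip i v) = p v /\ c (flip i v) = c v,
      forall chi v, chi \in F ->
        if p v == parity v then chi v != c v else chi v == c v,
      (#|F| * 4 ^ m <= 2 ^ u * 3 ^ m)%N &
      (96 * u + 3 * #|S| <= 48 * 2 ^ d + 32 * m)%N].
Proof.
move=> d_gt0 properF F0 smallU.
have agree chi v : chi \in F -> v \notin U -> chi v = chi0 v.
  rewrite inE => Fchi; apply: contraNeq => chiv.
  by apply/existsP; exists chi; rewrite Fchi.
have moves v : v \in U -> exists2 chi, chi \in F & chi v <> chi0 v.
  by rewrite inE => /existsP[chi /andP[Fchi /eqP]]; exists chi.
clearbody U.
(* The default [ord0] is never reached: at most d/24 of the neighbours of a vertex of [U] are in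
   [U], and [d] is positive. *)
pose c v := if v \in U then
    if [pick i | flip i v \notin U] is Some i then chi0 (flip i v) else ord0
  else chi0 v.
have nbr v : v \in U -> exists i, flip i v \notin U /\ c v = chi0 (flip i v).
  move=> Uv; rewrite /c Uv; case: pickP => [i nUi|allU]; first by exists i.
  have : dg U v = d.
    rewrite -[RHS]card_ord -sum1_card; apply: eq_bigr => i _.
    by have /negbFE -> := allU i.
  by have := smallU v Uv; lia.
have avoid chi v : chi \in F -> v \in U -> chi v != c v.
  move=> Fchi /nbr[i [nUi ->]]; rewrite -(agree chi) //.
  by apply: proper_flip; apply: (subsetP properF).
(* Two differently coloured decided neighbours would leave a single colour at [v], where [chi] and
   [chi0] differ. *)
have cE v i : v \in U -> flip i v \notin U -> chi0 (flip i v) = c v.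
  move=> Uv nUi; apply/eqP; case: (boolP (_ == _)) => // neq.
  have [chi Fchi []] := moves v Uv.
  apply: (@avoid2_eq _ _ _ _ neq); try exact: avoid.
    by rewrite -(agree chi) //; apply: proper_flip; apply: (subsetP properF).
  by apply: proper_flip; apply: (subsetP properF).
have [X [m [XU cardX coverX countX]]] := list_count U.
(* The thresholds 3/8 and 1/8 satisfy 2 (3/8 + 1/8) = 1: two adjacent decided vertices strictly
   below both would contradict [dg_ge_union]. *)
pose X' := [set v | (3 * d <= 8 * dg X v)%N].
pose Z := [set v in ~: U | (d <= 8 * dg (~: U) v)%N].
exists (X :|: X' :|: Z), c, (fun v => parity v (+) (v \notin U)), #|U|, m.
have good v i : v \notin X :|: X' :|: Z -> flip i v \notin X :|: X' :|: Z ->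
    (v \in U) = (flip i v \notin U).
  rewrite !in_setU !negb_or -!andbA => /and3P[Xv X'v Zv] /and3P[Xw X'w Zw].
  case: (boolP (v \in U)) => Uv; case: (boolP (flip i v \in U)) => Uw //.
    by have := coverX v i Uv Uw; rewrite (negbTE Xv) (negbTE Xw).
  have : (d <= dg (~: U) v + dg (~: U) (flip i v) +
               (dg X v + dg X (flip i v)))%N.
    by apply: dg_ge_union => j; rewrite flipC => /andP[]; apply: coverX.
  move: X'v X'w Zv Zw; rewrite 2!inE -!ltnNge !inE Uv Uw /= -!ltnNge; lia.
split.
- move=> v i Sv Sw; have Uvw := good v i Sv Sw.
  rewrite parity_flip Uvw negbK; split; first by case: parity; case: (_ \in U).
  case: (boolP (flip i v \in U)) Uvw => Uw Uv.
    by have := cE (flip i v) i Uw; rewrite flipK Uv /= => <- //; rewrite /c Uv.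
  by rewrite -(cE v i) ?Uv // /c (negbTE Uw).
- move=> chi v Fchi; case: (boolP (v \in U)) => Uv /=.
    by rewrite addbF eqxx avoid.
  by rewrite addbT eq_sym; case: parity; rewrite /= /c (negbTE Uv) agree.
- apply: (countX c) => // chi chi' v F1 F2 Uv; by rewrite (agree chi) // (agree chi').
have balance := ee_balance U.
have eU : (6 * ee U U <= m * d)%N.
  have := ee_cover coverX XU.
  have : (24 * ee X U <= #|X| * d)%N.
    rewrite /ee big_distrr /= -sum_nat_const; apply: leq_sum => v Xv.
    exact/smallU/(subsetP XU).
  rewrite cardX; lia.
have cX' : (3 * d * #|X'| <= 8 * (d * #|X|))%N.
  by apply: markov_card => v; rewrite inE.
have cZ : (d * #|Z| <= 8 * ee (~: U) (~: U))%N.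
  apply: (@leq_trans (8 * ee Z (~: U))).
    rewrite /ee big_distrr /= mulnC -sum_nat_const; apply: leq_sum => v.
    by rewrite inE => /andP[].
  by rewrite leq_mul2l eeSl //; apply/subsetP=> v; rewrite inE => /andP[].
have cS : (#|X :|: X' :|: Z| <= #|X| + #|X'| + #|Z|)%N.
  apply: (leq_trans (leq_card_setU _ _)); rewrite leq_add2r.
  exact: leq_card_setU.
(* Multiply [balance] by 48. Its term for decided edges pays for [Z], while [eU], [X] and [X'] cost
   8m, 6m and 16m, within the allowed 32m. *)
rewrite -(leq_pmul2l d_gt0).
apply: (@leq_trans (d * (96 * #|U| + 3 * (#|X| + #|X'| + #|Z|)))).
  by rewrite leq_mul2l leq_add2l leq_mul2l cS !orbT.
move: balance eU cX' cZ; rewrite cardX -mul2n.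
move: (ee _ _) (ee _ _) #|U| #|X'| #|Z| (2 ^ d)%N => eU eF u x z n; clear; nia.
Qed.

(** * The container algorithm *)

Definition list_family d := {ffun cube d -> {set 'I_3}}.

Definition compatible d (L : list_family d) : {set colouring d} :=
  [set chi : colouring d | [forall x, chi x \in L x]].

Definition undecided d (L : list_family d) : {set cube d} :=
  [set v | (1 < #|L v|)%N].

(** The potential of the algorithm: every query lowers it, and it starts at 3 * 2^d, when all lists
    are full. *)
Definition weight d (L : list_family d) : nat := (\sum_v #|L v|)%N.

Definition drop_at d (L : list_family d) v c : list_family d :=
  [ffun x => if x == v then L x :\ c else L x].

Definition drop_nbrs d (L : list_family d) v c : list_family d :=
  [ffun x => if [exists i, x == flip i v] then L x :\ c else L x].

Lemma flip_injl d (v : cube d) : injective (fun i : 'I_d => flip i v).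
Proof.
move=> i j /ffunP/(_ i); rewrite !ffunE eqxx => /addbI/esym/eqP.
by [].
Qed.

Lemma weight_drop_at d (L : list_family d) v c :
  c \in L v -> (weight (drop_at L v c)).+1 = weight L.
Proof.
move=> Lc; rewrite /weight (bigD1 v) // [in RHS](bigD1 v) //= ffunE eqxx.
rewrite (cardsD1 c (L v)) Lc /= -addSn; congr (_ + _)%N.
by apply: eq_bigr => x xv; rewrite ffunE (negbTE xv).
Qed.

Lemma weight_drop_nbrs d (L : list_family d) v c :
  (weight (drop_nbrs L v c) + dg [set x | c \in L x] v)%N = weight L.
Proof.
have -> : dg [set x | c \in L x] v =
    (\sum_x [exists i, x == flip i v] * (c \in L x))%N.
  rewrite (bigID (mem [set flip i v | i in 'I_d])) /= [X in (_ + X)%N]big1.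
    rewrite addn0 big_imset /=; last by move=> i j _ _; apply: flip_injl.
    apply: eq_big => // i _; rewrite inE.
    have -> : [exists j, flip i v == flip j v] by apply/existsP; exists i.
    by rewrite mul1n.
  move=> x /imsetP nx; case: existsP => // -[i /eqP xi].
  by case: nx; exists i.
rewrite /weight -big_split /=; apply: eq_bigr => x _; rewrite ffunE.
case: existsP => _; last by rewrite mul0n addn0.
by rewrite (cardsD1 c (L x)) mul1n addnC.
Qed.

(** Take two colours in the list of [v]. An undecided neighbour lists two of the three colours,
    hence one of these; so one of them is listed by at least half of the undecided neighbours. *)
Lemma popular_colour d (L : list_family d) v :
  v \in undecided L ->
  exists2 c, c \in L v & (dg (undecided L) v <= 2 * dg [set x | c \in L x] v)%N.
Proof.
rewrite inE => /card_gt1P[a [b [La Lb ab]]].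
have H : (dg (undecided L) v <=
    dg [set x | a \in L x] v + dg [set x | b \in L x] v)%N.
  rewrite -big_split /=; apply: leq_sum => i _; rewrite !inE.
  case: ltnP => //= Lgt1.
  case: (boolP (a \in _)) => // nLa; case: (boolP (b \in _)) => // nLb.
  have : (#|L (flip i v) :|: [set a; b]| <= 3)%N.
    by rewrite -[X in (_ <= X)%N](card_ord 3); apply: max_card.
  rewrite cardsU cards2 ab (_ : _ :&: _ = set0) ?cards0 /=; first by lia.
  apply/setP=> e; rewrite !inE; apply/negP=> /andP[Le /orP[]/eqP E];
    by move: Le; rewrite E ?(negbTE nLa) ?(negbTE nLb).
case: (leqP (dg [set x | a \in L x] v) (dg [set x | b \in L x] v)) => ab'.
  by exists b => //; lia.
by exists a => //; lia.
Qed.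

(* Kleitman-Winston: query a vertex with many undecided neighbours for its most
   popular colour. A positive answer shortens many lists, a negative one
   shortens one, whence the recursion lam^(w-k) + lam^(w-1) <= lam^w. *)
Lemma container_count (R : realType) d (B : {set colouring d}) (k : nat)
    (lam M : R) :
  B \subset proper_colourings d -> (0 < k)%N -> (48 * k <= d)%N -> 1 <= lam ->
  0 <= M -> 1 + lam ^+ k.-1 <= lam ^+ k ->
  (forall L : list_family d,
     (forall v, v \in undecided L -> (24 * dg (undecided L) v <= d)%N) ->
     #|B :&: compatible L|%:R <= M) ->
  #|B|%:R <= M * lam ^+ (3 * 2 ^ d).
Proof.
move=> properB k_gt0 kd lam1 M0 lamk terminal.
have lam0 : 0 <= lam by lra.
suff H (L : list_family d) : #|B :&: compatible L|%:R <= M * lam ^+ weight L.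
  have := H [ffun=> setT]; rewrite (_ : compatible _ = setT).
    rewrite setIT => /le_trans; apply; rewrite ler_wpM2l // ler_weXn2l //.
    rewrite /weight (eq_bigr (fun=> 3%N)); first by rewrite sum_nat_const card_cube mulnC.
    by move=> v _; rewrite ffunE cardsT card_ord.
  by apply/setP=> chi; rewrite !inE; apply/forallP=> x; rewrite ffunE inE.
have [w] := ubnP (weight L); elim: w L => // w IH L ltLw.
case: (boolP [forall v in undecided L, 24 * dg (undecided L) v <= d]%N).
  move=> /forallP termL; apply: (le_trans (terminal L _)).
    by move=> v Uv; have := termL v; rewrite Uv.
  by rewrite ler_peMr // exprn_ege1.
rewrite negb_forall => /existsP[v]; rewrite negb_imply -ltnNge => /andP[Uv dv].
have [c Lc popc] := popular_colour Uv.
have w1 := weight_drop_at Lc; have w2 := weight_drop_nbrs L v c.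
have sub : B :&: compatible L \subset
    (B :&: compatible (drop_nbrs L v c)) :|: (B :&: compatible (drop_at L v c)).
  apply/subsetP=> chi; rewrite !inE => /andP[Bchi /forallP Lchi].
  rewrite Bchi /=; case: (eqVneq (chi v) c) => [chiv|chiv]; apply/orP.
    left; apply/forallP=> x; rewrite ffunE; case: existsP => // -[i /eqP xi].
    rewrite in_setD1 Lchi andbT xi -chiv eq_sym.
    by apply: proper_flip; apply: (subsetP properB).
  right; apply/forallP=> x; rewrite ffunE; case: eqVneq => // ->.
  by rewrite in_setD1 Lchi chiv.
have cardle := leq_trans (subset_leq_card sub) (leq_card_setU _ _).
(* More than d/24 neighbours of [v] are undecided, so [c] is listed by more than d/48 >= [k]
   neighbours. *)
have [lt1 lt2 le1 eq2 eqL] :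
    [/\ weight (drop_nbrs L v c) < w, weight (drop_at L v c) < w,
        weight (drop_nbrs L v c) <= weight L - k,
        weight (drop_at L v c) = weight L - k + k.-1 &
        weight L = weight L - k + k]%N.
  move: w1 w2 popc dv ltLw.
  move: (weight _) (weight _) (weight _) (dg _ _) (dg _ _) => W1 W2 W a b.
  by move: k_gt0 kd; clear; split; lia.
have IH1 := IH (drop_nbrs L v c) lt1.
have IH2 := IH (drop_at L v c) lt2.
have E1 : lam ^+ weight (drop_nbrs L v c) <= lam ^+ (weight L - k).
  exact: ler_weXn2l.
have E2 : lam ^+ weight (drop_at L v c) = lam ^+ (weight L - k) * lam ^+ k.-1.
  by rewrite -exprD eq2.
have E3 : lam ^+ weight L = lam ^+ (weight L - k) * lam ^+ k.
  by rewrite -exprD -eqL.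
move: cardle; rewrite -(ler_nat R) natrD => /le_trans; apply.
apply: (le_trans (lerD IH1 IH2)); rewrite -mulrDr ler_wpM2l // E2 E3.
apply: (le_trans (lerD E1 (lexx _))).
by rewrite -[X in X + _]mulr1 -mulrDr ler_wpM2l // exprn_ge0.
Qed.

(** * An isoperimetric inequality on the cube *)

Definition cube_cons d (b : bool) (y : cube d) : cube d.+1 :=
  [ffun i => if unlift ord0 i is Some j then y j else b].

Definition cube_tail d (x : cube d.+1) : cube d := [ffun j => x (lift ord0 j)].

Lemma cube_consK d b (y : cube d) :
  (cube_tail (cube_cons b y) = y) * (cube_cons b y ord0 = b).
Proof.
by split; [apply/ffunP=> j|]; rewrite !ffunE ?liftK ?unlift_none.
Qed.

Lemma cube_tailK d (x : cube d.+1) : cube_cons (x ord0) (cube_tail x) = x.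
Proof.
by apply/ffunP=> i; rewrite ffunE; case: unliftP => [j|] ->; rewrite ?ffunE.
Qed.

Lemma flip_cons0 d b (y : cube d) : flip ord0 (cube_cons b y) = cube_cons (~~ b) y.
Proof.
apply/ffunP=> i; rewrite !ffunE; case: unliftP => [j|] ->.
  by rewrite eq_sym (negbTE (neq_lift _ _)) addbF.
by rewrite eqxx addbT.
Qed.

Lemma flip_consS d b j (y : cube d) :
  flip (lift ord0 j) (cube_cons b y) = cube_cons b (flip j y).
Proof.
apply/ffunP=> i; rewrite !ffunE; case: unliftP => [k|] ->.
  by rewrite ffunE (inj_eq lift_inj).
by rewrite (negbTE (neq_lift _ _)) addbF.
Qed.

Lemma big_cube_cons (V : nmodType) d (G : cube d.+1 -> V) :
  \sum_x G x = \sum_y G (cube_cons false y) + \sum_y G (cube_cons true y).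
Proof.
rewrite (bigID (fun x : cube d.+1 => x ord0)) /= addrC.
have half b : \sum_(x : cube d.+1 | x ord0 == b) G x = \sum_y G (cube_cons b y).
  rewrite (reindex (@cube_cons d b)) /=.
    by apply: eq_bigl => y; rewrite cube_consK eqxx.
  exists (@cube_tail d) => [y _|x]; first by rewrite cube_consK.
  by rewrite inE => /eqP <-; rewrite cube_tailK.
rewrite -!half; congr (_ + _); apply: eq_bigl => x; by case: (x ord0).
Qed.

(* [q] is the loss of density between two opposite facets; Cauchy-Schwarz with
   the vector (1 - q^2, q), of norm at most 1, linearises the square root. *)
Lemma sqrt_add_ge (R : realType) (h q : R) (e : bool) :
  0 <= h -> 0 <= q <= 1 ->
  (1 - q ^+ 2) * Num.sqrt h + q * e%:R <= Num.sqrt (h + e%:R).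
Proof.
move=> h0 /andP[q0 q1]; have s0 := sqrtr_ge0 h; have hE := sqr_sqrtr h0.
set s := Num.sqrt h in s0 hE *.
case: e; last by rewrite mulr0 !addr0 -/s; nra.
have t0 := sqrtr_ge0 (h + 1); have tE : Num.sqrt (h + 1) ^+ 2 = h + 1.
  by rewrite sqr_sqrtr //; lra.
have q2 : 0 <= 1 - q ^+ 2 by nra.
rewrite mulr1 -(ler_pXn2r (ltn0Sn 1)) ?nnegrE //; last first.
  by rewrite addr_ge0 ?mulr_ge0.
rewrite tE -hE.
have := sqr_ge0 (q * s - (1 - q ^+ 2)).
have : 0 <= q ^+ 2 * (1 - q ^+ 2) * (1 + s ^+ 2).
  by rewrite !mulr_ge0 ?sqr_ge0 // addr_ge0 ?sqr_ge0.
lra.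
Qed.

(** Let q = a - b. The parabola x (1 - x) at the midpoint exceeds its mean at [a] and [b] by q^2/4,
    while a (1 - a) <= 1/4 leaves the right side an excess of at least 3 q^2/8. *)
Lemma two_point (R : realType) (a b U W : R) :
  0 <= b -> b <= a -> a <= 1 -> a * (1 - a) <= U -> b * (1 - b) <= W ->
  (a + b) / 2 * (1 - (a + b) / 2) <=
  ((1 - (a - b) ^+ 2) * U + (a - b) * (a - b) + W) / 2.
Proof.
move=> b0 ba a1 HU HW.
have q2 : 0 <= 1 - (a - b) ^+ 2 by nra.
have H1 : (1 - (a - b) ^+ 2) * (a * (1 - a)) <= (1 - (a - b) ^+ 2) * U.
  exact: ler_wpM2l.
have H2 : 0 <= (a - b) ^+ 2 * (1 - 2 * a) ^+ 2 by apply: mulr_ge0; apply: sqr_ge0.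
have H3 := sqr_ge0 (a - b).
lra.
Qed.

(** Its mean over the cube is a Bobkov-type measure of the boundary of [A], intermediate between the
    edge boundary and the inner vertex boundary. *)
Definition inner (R : realType) d (A : {set cube d}) (x : cube d) : R :=
  (x \in A)%:R * Num.sqrt (dg (~: A) x)%:R.

Lemma inner_ge0 (R : realType) d (A : {set cube d}) x : 0 <= inner R A x.
Proof. by rewrite mulr_ge0 ?sqrtr_ge0. Qed.

Definition facet d (A : {set cube d.+1}) b : {set cube d} :=
  [set y | cube_cons b y \in A].

Lemma inner_cons (R : realType) d (A : {set cube d.+1}) b y :
  inner R A (cube_cons b y) = (y \in facet A b)%:R *
    Num.sqrt ((dg (~: facet A b) y)%:R + (y \notin facet A (~~ b))%:R).
Proof.
rewrite /inner !inE; congr (_ * Num.sqrt _).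
rewrite -natrD /dg big_ord_recl /= flip_cons0 !inE addnC; congr (_%:R); congr (_ + _)%N.
by apply: eq_bigr => j _; rewrite flip_consS !inE.
Qed.

Definition density (R : realType) d (A : {set cube d}) : R := #|A|%:R / 2 ^+ d.

Lemma card_sum (R : realType) (T : finType) (A : {set T}) : #|A|%:R = \sum_x (x \in A)%:R :> R.
Proof.
rewrite -sum1_card natr_sum [LHS]big_mkcond.
by apply: eq_bigr => x _; case: (x \in A).
Qed.

Lemma density_cons (R : realType) d (A : {set cube d.+1}) :
  density R A = (density R (facet A false) + density R (facet A true)) / 2.
Proof.
have cardE b : \sum_y (cube_cons b y \in A)%:R = #|facet A b|%:R :> R.
  by rewrite card_sum; apply: eq_bigr => y _; rewrite inE.
rewrite /density card_sum big_cube_cons !cardE exprS; field.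
by rewrite expf_neq0 ?pnatr_eq0.
Qed.

Lemma density_itv (R : realType) d (A : {set cube d}) : 0 <= density R A <= 1.
Proof.
rewrite divr_ge0 ?exprn_ge0 //= ler_pdivrMr ?exprn_gt0 // mul1r.
by rewrite -natrX -card_cube ler_nat max_card.
Qed.

(** [sqrt_add_ge] is summed with slope [q]: the additional boundary edges sit over [A0 :\: A1],
    whose density is at least [q]. *)
Lemma facet_step (R : realType) d (A0 A1 : {set cube d}) (q := density R A0 - density R A1) :
  0 <= q ->
  (1 - q ^+ 2) * ((\sum_y inner R A0 y) / 2 ^+ d) + q * q <=
  (\sum_y (y \in A0)%:R *
     Num.sqrt ((dg (~: A0) y)%:R + (y \notin A1)%:R)) / 2 ^+ d.
Proof.
move=> q0; have q1 : q <= 1.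
  by have := density_itv R A0; have := density_itv R A1; rewrite /q; lra.
have q01 : 0 <= q <= 1 by rewrite q0.
have qE : q = (\sum_y ((y \in A0)%:R - (y \in A1)%:R)) / 2 ^+ d.
  by rewrite sumrB -!card_sum mulrBl.
rewrite [q * q]mulrC [X in _ + _ * X]qE !mulrA -mulrDl !mulr_sumr -big_split /=.
rewrite ler_wpM2r ?invr_ge0 ?exprn_ge0 //; apply: ler_sum => y _.
have := sqrt_add_ge (y \notin A1) (ler0n R (dg (~: A0) y)) q01.
rewrite /inner; case: (y \in A0); case: (y \in A1); rewrite /= ?mul1r ?mul0r; lra.
Qed.

(** Induction on the dimension: the denser facet gains by [facet_step], on the other one the edges
    between facets are dropped, and [two_point] combines the two. *)
Lemma isoperimetry (R : realType) d (A : {set cube d}) :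
  density R A * (1 - density R A) <= (\sum_x inner R A x) / 2 ^+ d.
Proof.
elim: d A => [|d IH] A.
  have -> : density R A * (1 - density R A) = 0.
    have : (#|A| <= 1)%N by rewrite (leq_trans (max_card _)) // card_cube.
    rewrite /density expr0 divr1.
    by case: #|A| => [|[|]] // _; rewrite ?mul0r ?subrr ?mulr0.
  by rewrite divr_ge0 ?exprn_ge0 //; apply: sumr_ge0 => x _; apply: inner_ge0.
pose S b : R := (\sum_y inner R A (cube_cons b y)) / 2 ^+ d.
have -> : (\sum_x inner R A x) / 2 ^+ d.+1 = (S false + S true) / 2.
  rewrite big_cube_cons /S exprS; field.
  by rewrite expf_neq0 ?pnatr_eq0.
have large b : density R (facet A (~~ b)) <= density R (facet A b) ->
    (1 - (density R (facet A b) - density R (facet A (~~ b))) ^+ 2) *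
      ((\sum_y inner R (facet A b) y) / 2 ^+ d) +
      (density R (facet A b) - density R (facet A (~~ b))) *
      (density R (facet A b) - density R (facet A (~~ b))) <= S b.
  rewrite -subr_ge0 => /facet_step/le_trans; apply.
  rewrite /S ler_wpM2r ?invr_ge0 ?exprn_ge0 //; apply: ler_sum => y _.
  by rewrite inner_cons.
have small b : (\sum_y inner R (facet A b) y) / 2 ^+ d <= S b.
  rewrite /S ler_wpM2r ?invr_ge0 ?exprn_ge0 //; apply: ler_sum => y _.
  rewrite inner_cons /inner ler_wpM2l // ler_wsqrtr // lerDl.
  exact: ler0n.
have IH0 := IH (facet A false); have IH1 := IH (facet A true).
have /andP[a0 a1] := density_itv R (facet A false).
have /andP[b0 b1] := density_itv R (facet A true).
rewrite density_cons.
have [ba|/ltW ab] := lerP (density R (facet A true)) (density R (facet A false)).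
  apply: (le_trans (two_point b0 ba a1 IH0 IH1)).
  by rewrite ler_wpM2r ?invr_ge0 // lerD // large.
rewrite [X in X / 2 * _]addrC [X in _ * (1 - X / 2)]addrC.
apply: (le_trans (two_point a0 ab b1 IH1 IH0)).
by rewrite ler_wpM2r ?invr_ge0 // [leRHS]addrC lerD // (large true).
Qed.

(** The integrand of [isoperimetry] vanishes off [S] and is at most the square root of [d] on it. *)
Lemma separator (R : realType) d (A S : {set cube d}) :
  (forall x i, x \in A -> flip i x \notin A -> x \in S) ->
  density R A * (1 - density R A) <= Num.sqrt d%:R * density R S.
Proof.
move=> sepS; apply: (le_trans (isoperimetry R A)).
rewrite /density mulrA ler_wpM2r ?invr_ge0 ?exprn_ge0 // card_sum mulr_sumr.
apply: ler_sum => x _; rewrite /inner.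
case: (boolP (x \in A)) => Ax; last by rewrite mul0r mulr_ge0 ?sqrtr_ge0.
case: (boolP (x \in S)) => Sx.
  by rewrite mul1r mulr1 ler_wsqrtr // ler_nat dg_le.
rewrite (_ : dg _ _ = 0%N) ?sqrtr0 ?mulr0 //.
apply: big1 => i _; rewrite inE; case: (boolP (flip i x \in A)) => // Ay.
by rewrite (sepS x i) in Sx.
Qed.

(** * Chernoff's bound and families dominated by one phase *)

Lemma sum_subset_exp (R : realType) (T : finType) (E : {set T}) (y : R) :
  0 <= y -> \sum_(A in powerset E) y ^+ #|A| <= (1 + y) ^+ #|E|.
Proof.
move=> y0; pose F i : R := if i \in E then y else 0.
have -> : (1 + y) ^+ #|E| = \prod_i (F i + 1).
  rewrite -prodr_const big_mkcond; apply: eq_bigr => i _; rewrite /F.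
  by case: (i \in E); [rewrite addrC | rewrite add0r].
rewrite bigA_distr big_mkcond; apply: ler_sum => A _.
case: (boolP (A \in powerset E)) => [|_].
  rewrite powersetE => /subsetP AE; rewrite -prodr_const big_mkcond /=.
  by apply: ler_prod => i _; rewrite /F; case: (boolP (i \in A)) => [/AE ->|];
     rewrite ?y0 ?ler01 lexx.
by apply: prodr_ge0 => i _; rewrite /F; case: ifP => // _; case: ifP.
Qed.

(** Chernoff's bound: give [A] the weight y^|A| with y < 1. Each set counted weighs at least
    y^(theta |E|), and all subsets of [E] together weigh at most (1 + y)^|E|. *)
Lemma small_subsets (R : realType) (theta : R) :
  0 <= theta < 1 / 2 -> exists2 kappa : R, 0 < kappa &
  forall (T : finType) (E : {set T}),
    #|[set A in powerset E | #|A|%:R <= theta * #|E|%:R]|%:R <=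
    expR ((ln 2 - kappa) * #|E|%:R).
Proof.
(* The midpoint of 2 [theta] and 1; being above 2 [theta] is what makes the rate positive, through
   [H3]. *)
move=> /andP[t0 t1]; pose y : R := (1 + 2 * theta) / 2.
have y0 : 0 < y by rewrite /y; lra.
have y1 : y < 1 by rewrite /y; lra.
exists (ln 2 - (ln (1 + y) - theta * ln y)).
  have H1 : ln (1 + y) <= ln 2 + (y - 1) / 2.
    have -> : 1 + y = 2 * (1 + (y - 1) / 2) by field.
    rewrite lnM ?posrE; [|lra|lra].
    by rewrite lerD2l le_ln1Dx //; lra.
  have H2 : - ln y <= y^-1 - 1.
    rewrite -lnV ?posrE // -[X in ln X](subrK 1) [X in ln X]addrC le_ln1Dx //.
    by rewrite ltrBrDl subrr invr_gt0.
  have H3 : theta * (y^-1 - 1) < (1 - y) / 2.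
    have yV : y * y^-1 = 1 by rewrite mulfV // gt_eqF.
    have -> : y^-1 - 1 = (1 - y) * y^-1 by lra.
    rewrite mulrCA ltr_pM2l; last by lra.
    by rewrite ltr_pdivrMr // /y; lra.
  have := ler_wpM2l t0 H2; lra.
move=> T E; rewrite opprB addrC subrK.
have lny : ln y <= 0 by rewrite ln_le0 // ltW.
have -> : expR ((ln (1 + y) - theta * ln y) * #|E|%:R) =
    (1 + y) ^+ #|E| * expR (- (theta * #|E|%:R * ln y)).
  rewrite mulrBl expRD; congr (_ * expR _); last by rewrite mulrAC.
  by rewrite mulrC expRM_natl lnK // posrE; lra.
apply: (@le_trans _ _ ((\sum_(A in powerset E) y ^+ #|A|) *
    expR (- (theta * #|E|%:R * ln y)))); last first.
  by rewrite ler_wpM2r ?expR_ge0 // sum_subset_exp // ltW.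
rewrite -sum1_card natr_sum mulr_suml.
rewrite [leLHS]big_mkcond [leRHS]big_mkcond /=; apply: ler_sum => A _.
rewrite inE; case: (A \in powerset E) => //=; case: ifP => [Asmall|_]; last first.
  by rewrite mulr_ge0 ?expR_ge0 // exprn_ge0 // ltW.
rewrite -{1}(lnK y0) -expRM_natl -expRD -[leLHS]expR0 ler_expR; nra.
Qed.

(** A member is recovered from its values on [D] and its set of vertices of colour [i] on the free
    side: off [D], the other side has colour [c], and [i] tells apart the two colours of a free
    vertex. *)
Lemma dominated_count (R : realType) d (F : {set colouring d})
    (c i : 'I_3) (b : bool) (D : {set cube d}) (t : R) :
  i != c ->
  (forall chi v, chi \in F -> v \notin D ->
     if parity v == b then chi v != c else chi v == c) ->
  (forall chi, chi \in F -> #|colour_class chi i :&: side d b|%:R <= t) ->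
  (#|F| <= 3 ^ #|D| * #|[set A in powerset (side d b) | (#|A|%:R <= t)%R]|)%N.
Proof.
move=> ic phase small.
pose f (chi : colouring d) : colouring d * {set cube d} :=
  ([ffun v => if v \in D then chi v else ord0], colour_class chi i :&: side d b).
pose P := [set g : colouring d | g \in pffun_on ord0 (mem D) (mem setT)].
have cardP : #|P| = (3 ^ #|D|)%N.
  by rewrite cardsE card_pffun_on cardsT card_ord.
rewrite -cardP -cardsX -(card_in_imset (f := f)).
  apply/subset_leq_card/subsetP=> _ /imsetP[chi Fchi ->].
  rewrite !inE /= small // andbT subsetIr andbT.
  apply/pffun_onP; split; last by move=> x _; rewrite inE.
  by apply/subsetP=> v; rewrite !inE ffunE; case: ifP; rewrite ?eqxx.
move=> chi chi' F1 F2 [/ffunP ED /setP EA]; apply/ffunP=> v.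
case: (boolP (v \in D)) => Dv; first by have := ED v; rewrite !ffunE Dv.
have := phase chi v F1 Dv; have := phase chi' v F2 Dv.
case: eqP => [vb|_] c2 c1; last by rewrite (eqP c1) (eqP c2).
apply: (avoid_eq ic) => //.
by have := EA v; rewrite !inE vb eqxx !andbT.
Qed.

(** * Terminal families: a dominant phase or a large separator *)

Lemma densityC (R : realType) d (A : {set cube d}) :
  density R (~: A) = 1 - density R A.
Proof.
rewrite /density cardsCs setCK card_cube natrB; last first.
  by rewrite -card_cube max_card.
by rewrite mulrBl natrX mulfV // expf_neq0 // pnatr_eq0.
Qed.

(* The complement of a phase class has its inner boundary inside S, so
   isoperimetry applies to the class of largest density. *)
Lemma phase_dichotomy (R : realType) d (S : {set cube d}) (I : finType)
    (lab : cube d -> I) (e : R) :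
  (0 < d)%N -> (0 < #|I|)%N -> 0 <= e <= 1 ->
  (forall v i, v \notin S -> flip i v \notin S -> lab (flip i v) = lab v) ->
  (exists l, density R (~: [set v | (v \notin S) && (lab v == l)]) < e) \/
  e / (2 * #|I|%:R) <= Num.sqrt d%:R * density R S.
Proof.
move=> d_gt0 I_gt0 /andP[e0 e1] labP; pose P l := [set v | (v \notin S) && (lab v == l)].
have I1 : 1 <= #|I|%:R :> R by rewrite ler1n.
case: (boolP [exists l, density R (~: P l) < e]) => [/existsP[l Pl]|]; first by left; exists l.
rewrite negb_exists => /forallP noP; right.
have s1 : 1 <= Num.sqrt d%:R :> R by rewrite -[leLHS]sqrtr1 ler_wsqrtr // ler1n.
have /andP[S0 S1] := density_itv R S.
(* If [S] fills half of the cube the bound is immediate; otherwise the classes share at least half,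
   and one has density at least 1 / (2|I|). *)
have [S2|S2] := lerP (1 / 2) (density R S).
  rewrite (@le_trans _ _ (1 / 2)) //; last by nra.
  by rewrite ler_pdivrMr; nra.
have [l Pl] : exists l, 1 / (2 * #|I|%:R) <= density R (P l).
  apply/existsP; apply: contraLR S2; rewrite negb_exists => /forallP small.
  rewrite -leNgt; have -> : density R S = 1 - \sum_l density R (P l).
    rewrite -[S]setCK densityC; congr (1 - _).
    rewrite /density -mulr_suml card_sum; congr (_ / _).
    under [RHS]eq_bigr do rewrite card_sum.
    rewrite exchange_big; apply: eq_bigr => v _; rewrite !inE /=.
    rewrite (bigD1 (lab v)) //= big1 ?addr0; first by rewrite inE eqxx andbT.
    by move=> l /negbTE lv; rewrite inE eq_sym lv andbF.
  have : \sum_l density R (P l) <= \sum_(l : I) 1 / (2 * #|I|%:R).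
    by apply: ler_sum => l _; rewrite ltW // ltNge small.
  rewrite sumr_const -[X in _ <= X -> _]mulr_natl => /le_trans; move/(_ (1 / 2)).
  have -> : #|I|%:R * (1 / (2 * #|I|%:R)) = 1 / 2 :> R.
    by field; rewrite gt_eqF //; lra.
  by rewrite lexx => /(_ isT); lra.
have sep : density R (~: P l) * (1 - density R (~: P l)) <=
    Num.sqrt d%:R * density R S.
  apply: separator => x i; rewrite !inE negbK => nP /andP[Sy ly].
  apply: contraNT nP => Sx; by rewrite Sx -(labP x i).
apply: le_trans sep; have := noP l; rewrite -leNgt => eP.
have -> : 1 - density R (~: P l) = density R (P l) by rewrite densityC subKr.
rewrite div1r in Pl.
by rewrite ler_pM // invr_ge0 mulr_ge0.
Qed.

(** As (3/4)^3 < 1/2, the matching saves a factor 2^(m/3), exactly the amount m/3 by which [u] may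
    exceed n - s/32. *)
Lemma container_exp (R : realType) (f u m s n : nat) :
  (f * 4 ^ m <= 2 ^ u * 3 ^ m)%N -> (96 * u + 3 * s <= 96 * n + 32 * m)%N ->
  f%:R <= 2 ^+ n * expR (- (ln 2 * s%:R / 32)) :> R.
Proof.
move=> fle ule.
have l2 : 0 < ln 2 :> R by rewrite ln_gt0 // ltr1n.
have E2 k : 2 ^+ k = expR (k%:R * ln 2) :> R.
  by rewrite expRM_natl lnK // posrE.
have l34 : 3 * ln (3 / 4) <= - ln 2 :> R.
  rewrite -lnV ?posrE // mulr_natl -lnXn ?divr_gt0 // ler_ln ?posrE ?exprn_gt0 ?invr_gt0 ?divr_gt0 //.
  lra.
have E34 : (3 / 4) ^+ m = expR (m%:R * ln (3 / 4)) :> R.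
  by rewrite expRM_natl lnK // posrE divr_gt0.
have : f%:R <= 2 ^+ u * (3 / 4) ^+ m :> R.
  rewrite exprMn exprVn mulrA ler_pdivlMr ?exprn_gt0 //.
  by rewrite -!natrX -!natrM ler_nat.
move/le_trans; apply; rewrite !E2 E34 -!expRD ler_expR.
move: ule; rewrite -(ler_nat R) natrD [leRHS]natrD !natrM => ule.
have m0 : 0 <= m%:R :> R by [].
nra.
Qed.

Lemma imbalance_card (R : realType) d (chi : colouring d.+1) i b (rho : R) :
  `| proportion (colour_class chi i) (evens d.+1)
     - proportion (colour_class chi i) (odds d.+1) | <= rho ->
  `| #|colour_class chi i :&: side d.+1 b|%:R
     - #|colour_class chi i :&: side d.+1 (~~ b)|%:R | <= rho * 2 ^+ d.
Proof.
have n0 : 0 < 2 ^+ d :> R by rewrite exprn_gt0.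
rewrite /proportion !sideE !card_side natrX -mulrBl normrM normfV.
rewrite [`|2 ^+ d|](ger0_norm (ltW n0)) ler_pdivrMr //.
by case: b => //=; rewrite distrC.
Qed.

(** A colour [i] other than [c] hardly occurs on the fixed side, so near balance makes it rare on
    the free side, where Chernoff's bound applies. For [i = c] near balance is impossible. *)
Lemma dominated_bound (R : realType) (rho e theta kappa : R) d
    (F : {set colouring d.+1}) (c i : 'I_3) (b : bool) (D : {set cube d.+1}) :
  0 <= rho -> e <= (1 / 2 - rho) / 4 -> e <= kappa / 8 ->
  rho + 2 * e <= theta -> 0 <= e ->
  (forall (T : finType) (E : {set T}),
    #|[set A in powerset E | #|A|%:R <= theta * #|E|%:R]|%:R <=
    expR ((ln 2 - kappa) * #|E|%:R)) ->
  (forall chi v, chi \in F -> v \notin D ->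
     if parity v == b then chi v != c else chi v == c) ->
  (forall chi, chi \in F ->
    `| proportion (colour_class chi i) (evens d.+1)
       - proportion (colour_class chi i) (odds d.+1) | <= rho) ->
  density R D < e ->
  #|F|%:R <= 2 ^+ (2 ^ d) * expR (- (kappa / 2 * 2 ^+ d)).
Proof.
move=> rho0 e1 e2 etheta e0 subsets phase bal De.
have n0 : 0 < 2 ^+ d :> R by rewrite exprn_gt0.
have cD : #|D|%:R < 2 * e * 2 ^+ d.
  by move: De; rewrite /density ltr_pdivrMr ?exprn_gt0 // exprS mulrCA mulrA.
have cD' (chi : colouring d.+1) a (H : {set cube d.+1}) :
    {in H, forall v, v \notin D -> chi v != a} ->
    #|colour_class chi a :&: H|%:R <= #|D|%:R :> R.
  move=> HD; rewrite ler_nat; apply/subset_leq_card/subsetP=> v.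
  rewrite !inE => /andP[va Hv]; apply: contraLR va => Dv; exact: HD.
have [ic|ic] := eqVneq i c; last first.
  have small chi : chi \in F ->
      #|colour_class chi i :&: side d.+1 b|%:R <= theta * #|side d.+1 b|%:R.
    move=> Fchi; have := imbalance_card b (bal chi Fchi).
    have : #|colour_class chi i :&: side d.+1 (~~ b)|%:R <= #|D|%:R :> R.
      apply: cD' => v; rewrite inE => /eqP vb Dv.
      have := phase chi v Fchi Dv; rewrite vb; case: (b) => /= /eqP ->;
      by rewrite eq_sym.
    rewrite card_side natrX ler_norml => H1 /andP[_ H2].
    have := ler_wpM2r (ltW n0) etheta; lra.
  have := dominated_count ic phase small; rewrite -(ler_nat R) natrM => /le_trans; apply.
  (* Here 3 <= exp 2, and [e <= kappa / 8] makes this loss at most half of the gain [kappa]. *)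
  have E3 : (3 ^ #|D|)%:R <= expR (4 * e * 2 ^+ d) :> R.
    rewrite natrX; apply: (@le_trans _ _ (expR 2 ^+ #|D|)).
      by rewrite lerXn2r ?nnegrE ?expR_ge0 // (le_trans _ (expR_ge1Dx _)) //; lra.
    rewrite -expRM_natl ler_expR; nra.
  apply: (le_trans (ler_pM _ _ E3 (subsets _ _))) => //.
  have -> : 2 ^+ (2 ^ d) = expR ((2 ^ d)%:R * ln 2) :> R.
    by rewrite expRM_natl lnK // posrE.
  rewrite card_side !natrX -!expRD ler_expR.
  move: (ler_wpM2r (ltW n0) e2); move: (2 ^+ d) (ln 2) => n l; clear; lra.
(* Now [i = c]: this colour misses at most |D| vertices of the fixed side and takes at most |D| of
   the free one, so the proportions differ by more than 1/2 + [rho]. *)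
case: (set_0Vmem F) => [->|[chi Fchi]].
  by rewrite cards0 mulr_ge0 ?expR_ge0 ?exprn_ge0.
have := imbalance_card b (bal chi Fchi).
have H1 : #|colour_class chi i :&: side d.+1 b|%:R <= #|D|%:R :> R.
  apply: cD' => v; rewrite inE => vb Dv.
  by have := phase chi v Fchi Dv; rewrite vb ic.
have H2 : 2 ^+ d - #|D|%:R <= #|colour_class chi i :&: side d.+1 (~~ b)|%:R :> R.
  rewrite lerBlDr -natrX -(card_side d (~~ b)) -natrD ler_nat.
  apply: leq_trans (leq_card_setU _ D); apply/subset_leq_card/subsetP=> v.
  rewrite !inE => vb; rewrite vb andbT ic.
  case: (boolP (v \in D)) => [|Dv]; first by rewrite orbT.
  by have := phase chi v Fchi Dv; rewrite (eqP vb); case: (b) => /= ->.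
rewrite distrC => /(le_trans (ler_norm _)).
have := ler_wpM2r (ltW n0) e1; lra.
Qed.

(** Members of [F] differ only at undecided vertices of [L], so [terminal_structure] applies. A
    dominant phase falls under [dominated_bound], and a large separator gains through
    [container_exp]. *)
Lemma terminal_bound (R : realType) (rho : R) :
  0 <= rho < 1 / 2 -> exists2 c1 : R, 0 < c1 &
  forall d i (F : {set colouring d.+1}) (L : list_family d.+1),
  F \subset proper_colourings d.+1 -> F \subset compatible L ->
  (forall v, v \in undecided L -> (24 * dg (undecided L) v <= d.+1)%N) ->
  (forall chi, chi \in F ->
    `| proportion (colour_class chi i) (evens d.+1)
       - proportion (colour_class chi i) (odds d.+1) | <= rho) ->
  #|F|%:R <= 2 ^+ (2 ^ d) * expR (- (c1 * 2 ^+ d / Num.sqrt d.+1%:R)).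
Proof.
move=> /andP[rho0 rho1]; pose theta := (rho + 1 / 2) / 2.
have [|kappa k0 subsets] := @small_subsets R theta; first by rewrite /theta; lra.
pose e := Num.min ((1 / 2 - rho) / 4) (kappa / 8).
have e1 : e <= (1 / 2 - rho) / 4 by rewrite /e ge_min lexx.
have e2 : e <= kappa / 8 by rewrite /e ge_min lexx orbT.
have e0 : 0 < e by rewrite /e lt_min; lra.
have l2 : 0 < ln 2 :> R by rewrite ln_gt0 // ltr1n.
(* 192 = 6 * 32: with six phases |S| is at least e 2^d / (6 sqrt(d+1)), and [container_exp] divides
   by 32. *)
exists (Num.min (kappa / 2) (ln 2 * e / 192)).
  by rewrite lt_min; apply/andP; split; nra.
set c1 := Num.min _ _.
have c11 : c1 <= kappa / 2 by rewrite /c1 ge_min lexx.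
have c12 : c1 <= ln 2 * e / 192 by rewrite /c1 ge_min lexx orbT.
have c10 : 0 < c1 by rewrite /c1 lt_min; apply/andP; split; nra.
move=> d i F L properF compF termL bal.
have s1 : 1 <= Num.sqrt d.+1%:R :> R by rewrite -[leLHS]sqrtr1 ler_wsqrtr // ler1n.
have s0 : 0 < Num.sqrt d.+1%:R :> R by lra.
have n0 : 0 < 2 ^+ d :> R by rewrite exprn_gt0.
case: (set_0Vmem F) => [->|[chi0 F0]].
  by rewrite cards0 mulr_ge0 ?expR_ge0 ?exprn_ge0.
have [|S [c [p [u [m [edges phase count sizes]]]]]] :=
    terminal_structure (ltn0Sn d) properF F0.
  have sub : [set v | [exists chi in F, chi v != chi0 v]] \subset undecided L.
    apply/subsetP=> v; rewrite !inE => /existsP[chi /andP[Fchi neq]].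
    have /forallP/(_ v) L1 : [forall x, chi x \in L x].
      by have := subsetP compF _ Fchi; rewrite inE.
    have /forallP/(_ v) L2 : [forall x, chi0 x \in L x].
      by have := subsetP compF _ F0; rewrite inE.
    by apply/card_gt1P; exists (chi v), (chi0 v).
  move=> v Uv; apply: leq_trans (termL v (subsetP sub v Uv)).
  by rewrite leq_mul2l dgS.
have [||||[[b a] Db]|Slarge] :=
    @phase_dichotomy R d.+1 S (bool * 'I_3)%type (fun v => (p v, c v)) e.
- by [].
- by rewrite card_prod card_bool card_ord.
- by lra.
- by move=> v j Sv Sw; have [-> ->] := edges v j Sv Sw.
- have := @dominated_bound R rho e theta kappa d F a i b
      (~: [set v | (v \notin S) && ((p v, c v) == (b, a))]).
  move=> /(_ rho0 e1 e2 _ (ltW e0) subsets _ bal Db)/le_trans; apply.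
  + by rewrite /theta; lra.
  + move=> chi v Fchi; rewrite !inE negbK => /andP[_ /eqP[pv cv]].
    by have := phase chi v Fchi; rewrite pv cv eq_sym.
  rewrite ler_wpM2l ?exprn_ge0 // ler_expR lerN2 ler_pdivrMr //.
  have : c1 * 2 ^+ d <= kappa / 2 * 2 ^+ d by rewrite ler_wpM2r // ltW.
  by move/le_trans; apply; rewrite ler_peMr // mulr_ge0 // ltW //; lra.
have sizes' : (96 * u + 3 * #|S| <= 96 * 2 ^ d + 32 * m)%N.
  move: sizes; rewrite expnS; move: (2 ^ d)%N #|S| => n k; clear; lia.
apply: (le_trans (container_exp R count sizes')).
rewrite ler_wpM2l ?exprn_ge0 // ler_expR lerN2 ler_pdivrMr //.
move: Slarge; rewrite card_prod card_bool card_ord /density exprS.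
rewrite mulrA ler_pdivlMr; last by lra.
move=> H; apply: (@le_trans _ _ (ln 2 * e / 192 * 2 ^+ d)).
  by rewrite ler_wpM2r // ltW.
move: (ler_wpM2l (ltW l2) H); rewrite -[(2 * 3)%N]/6%N.
move: (ln 2) (2 ^+ d) #|S|%:R (Num.sqrt _) => l n k s; clear; lra.
Qed.

(** * Explicit colourings: a lower bound and a biased example *)

(** The rare event for one colour. Despite the name, which [some_unbalanced] shares, it asks that
    the colour be nearly balanced between the two sides. *)
Definition unbalanced (R : realType) (rho : R) d (i : 'I_3) :
    {set colouring d} :=
  [set chi in proper_colourings d |
    `| proportion (colour_class chi i) (evens d)
       - proportion (colour_class chi i) (odds d) | <= rho].

(** Serves twice: all subsets of the even side give many proper colourings, and one half of it gives
    a biased one. In ['I_3], [- 1] is the colour 2. *)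
Definition two_sided d (A : {set cube d}) : colouring d :=
  [ffun x => if parity x then 0 else if x \in A then 1 else - 1].

Lemma two_sided_proper d (A : {set cube d}) :
  two_sided A \in proper_colourings d.
Proof.
rewrite inE; apply/forallP=> x; apply/forallP=> y; apply/implyP=> /cube_adjP[i ->].
by rewrite !ffunE parity_flip; case: parity => /=; case: ifP.
Qed.

Lemma card_proper_ge d : (2 ^ (2 ^ d) <= #|proper_colourings d.+1|)%N.
Proof.
rewrite -(card_side d false) -card_powerset.
rewrite -(card_in_imset (f := @two_sided d.+1)).
  by apply/subset_leq_card/subsetP=> _ /imsetP[A _ ->]; apply: two_sided_proper.
move=> A B; rewrite !powersetE => /subsetP AE /subsetP BE /ffunP AB.
apply/setP=> x; have := AB x; rewrite !ffunE.
case: (boolP (parity x)) => [px _|px].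
  have notin (C : {set cube d.+1}) :
      {subset C <= side d.+1 false} -> (x \in C) = false.
    by move=> CE; apply/negP=> /CE; rewrite inE px.
  by rewrite !notin.
by case: (x \in A); case: (x \in B).
Qed.

(** Flipping the first and the last coordinate, distinct in dimension [d.+2], keeps the parity and
    exchanges the two halves. *)
Lemma balanced_split d :
  #|[set x in side d.+2 false | x ord0]| = (2 ^ d)%N.
Proof.
pose A b := [set x in side d.+2 false | x ord0 == b].
have AE : #|A true| = #|A false|.
  pose f (x : cube d.+2) := flip ord0 (flip ord_max x).
  have fK : involutive f by move=> x; rewrite /f flipC !flipK.
  rewrite -(card_imset _ (inv_inj fK)); apply: eq_card => x.
  have fA b y : y \in A b -> f y \in A (~~ b).
    rewrite !inE /f !parity_flip !ffunE eqxx /= negbK => /andP[-> /eqP ->].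
    by case: b.
  apply/imsetP/idP => [[y yA ->]|xA]; first exact: (fA true).
  by exists (f x); [exact: (fA false)|rewrite fK].
have : (#|A true| + #|A false| = 2 ^ d.+1)%N.
  rewrite -(card_side _ false) -(cardsID [set x : cube d.+2 | x ord0] (side _ _)).
  by congr (_ + _)%N; apply: eq_card => x; rewrite !inE; case: (x ord0); rewrite ?andbT ?andbF.
have -> : [set x in side d.+2 false | x ord0] = A true.
  by apply/setP=> x; rewrite !inE; case: (x ord0).
rewrite -AE expnS; lia.
Qed.

(** Colour 0 fills the odd side only, and the others take half of the even side each: the
    differences are 1, 1/2 and 1/2. *)
Lemma exists_biased (R : realType) (rho : R) d :
  rho < 1 / 2 -> exists2 chi, chi \in proper_colourings d.+2 &
  forall i, chi \notin unbalanced rho d.+2 i.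
Proof.
move=> rho1; pose A := [set x in side d.+2 false | x ord0].
exists (two_sided A); first exact: two_sided_proper.
move=> i; rewrite inE two_sided_proper /= -ltNge /proportion !sideE !card_side.
have n0 : (2 ^ d.+1)%:R != 0 :> R by rewrite natrX expf_neq0 ?pnatr_eq0.
have [->|i0] := eqVneq i 0.
  have -> : colour_class (two_sided A) 0 :&: side d.+2 false = set0.
    by apply/setP=> x; rewrite !inE ffunE; case: parity => //=; case: ifP.
  have -> : colour_class (two_sided A) 0 :&: side d.+2 true = side d.+2 true.
    by apply/setP=> x; rewrite !inE ffunE; case: parity => //; rewrite andbC.
  rewrite card_side cards0 mul0r divff // sub0r normrN normr1; lra.
have -> : colour_class (two_sided A) i :&: side d.+2 true = set0.
  apply/setP=> x; rewrite !inE ffunE; case: parity; rewrite ?andbF //=.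
  by rewrite eq_sym (negbTE i0).
have -> : #|colour_class (two_sided A) i :&: side d.+2 false| = (2 ^ d)%N.
  have [i1|i1] := eqVneq i 1.
    rewrite -(balanced_split d) i1; apply: eq_card => x; rewrite !inE ffunE inE inE.
    by case: parity => //=; case: (x ord0).
  have i2 : i = - 1 by apply: (@avoid2_eq _ _ 0 1).
  have := cardsID A (side d.+2 false).
  rewrite card_side (_ : side _ _ :&: A = A); last first.
    by apply/setP=> x; rewrite !inE; case: parity.
  rewrite balanced_split expnS mul2n -addnn => /addnI <-.
  rewrite i2; apply: eq_card => x; rewrite !inE ffunE inE inE.
  by case: parity => //=; case: (x ord0).
have n1 : (2 ^ d)%:R != 0 :> R by rewrite natrX expf_neq0 ?pnatr_eq0.
rewrite cards0 mul0r subr0 expnS natrM invfM mulrCA divff // mulr1.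
by rewrite ger0_norm //; lra.
Qed.

(** * Parameters of the container algorithm *)

Lemma bernoulli_exp (R : realDomainType) (x : R) n :
  0 <= x -> 1 + n%:R * x <= (1 + x) ^+ n.
Proof.
move=> x0; elim: n => [|n IH]; first by rewrite mul0r addr0 expr0.
rewrite exprS; apply: (@le_trans _ _ ((1 + x) * (1 + n%:R * x))).
  have : 0 <= n%:R * x * x by rewrite !mulr_ge0.
  rewrite -natr1; lra.
by rewrite ler_wpM2l // addr_ge0.
Qed.

(** With s the square root of [d], the claim is that e/s times a power of 1 + e/s is at least 1.
    Bernoulli's inequality alone bounds the power by order s, which only gives a constant; squared,
    on half the exponent, it gives order s^2. *)
Lemma container_rate (R : realType) (e : R) (d : nat) :
  0 < e -> (300 <= d)%N -> 200 ^+ 2 / e ^+ 3 <= Num.sqrt d%:R ->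
  1 + (1 + e / Num.sqrt d%:R) ^+ (d %/ 48).-1 <=
  (1 + e / Num.sqrt d%:R) ^+ (d %/ 48).
Proof.
move=> e0 d_ge s_ge; set s := Num.sqrt _ in s_ge *.
have sE : s ^+ 2 = d%:R by rewrite sqr_sqrtr.
have s0 : 0 < s by rewrite sqrtr_gt0 ltr0n; lia.
have mu0 : 0 < e / s by rewrite divr_gt0.
have -> : (d %/ 48 = (d %/ 48).-1.+1)%N by lia.
rewrite exprS /= mulrDl mul1r addrC lerD2l.
set k := (d %/ 48).-1; pose j := k./2.
(* d < 48 (2j + 3), and d >= 300 forces j >= 2. *)
have jd : (d <= 200 * j)%N.
  have : (d %/ 48 = k.+1)%N by rewrite /k; lia.
  have := divn_eq d 48; have := ltn_pmod d (isT : 0 < 48)%N.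
  have := odd_double_half k; rewrite -/j; case: (odd k) => /=; lia.
have jR : s ^+ 2 <= 200 * j%:R by rewrite sE -natrM ler_nat.
have lam1 : 1 <= 1 + e / s by lra.
have H1 : (j%:R * (e / s)) ^+ 2 <= (1 + e / s) ^+ k.
  apply: (@le_trans _ _ ((1 + e / s) ^+ (j.*2))); last first.
    by apply: ler_weXn2l => //; rewrite -[X in (_ <= X)%N]odd_double_half leq_addl.
  rewrite -muln2 exprM ler_pXn2r ?nnegrE //; last by rewrite exprn_ge0 //; lra.
    by have := bernoulli_exp j (ltW mu0); lra.
  by rewrite mulr_ge0 // ltW.
have H2 : (s * (e / 200)) ^+ 2 <= (j%:R * (e / s)) ^+ 2.
  rewrite ler_pXn2r ?nnegrE //; last by rewrite mulr_ge0 // ltW.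
    rewrite mulrA ler_pdivlMr //.
    by have := ler_wpM2r (ltW e0) jR; rewrite expr2; lra.
  by rewrite mulr_ge0 ?divr_ge0 // ltW.
have H3 : 1 <= e / s * (s * (e / 200)) ^+ 2.
  have -> : e / s * (s * (e / 200)) ^+ 2 = s * e ^+ 3 / 200 ^+ 2.
    by field; rewrite gt_eqF.
  have e3 : 0 < e ^+ 3 by rewrite exprn_gt0.
  by rewrite ler_pdivlMr ?exprn_gt0 // mul1r -ler_pdivrMr.
apply: (le_trans H3); rewrite ler_wpM2l ?(ltW mu0) //.
exact: le_trans H2 H1.
Qed.

Lemma unbalanced_bound (R : realType) (rho : R) :
  0 <= rho < 1 / 2 -> exists2 c : R, 0 < c & exists d0 : nat,
  forall d i, (d0 <= d)%N ->
  #|unbalanced rho d.+1 i|%:R <=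
    2 ^+ (2 ^ d) * expR (- (c * 2 ^+ d / Num.sqrt d.+1%:R)).
Proof.
move=> rho01; have [c c0 bound] := terminal_bound rho01.
exists (c / 2); first by rewrite divr_gt0.
(* The containers cost exp(6 e 2^d / s), with this [e] half of the gain of a terminal family. *)
pose e := c / 12; have e0 : 0 < e by rewrite divr_gt0.
have b0 : 0 <= 200 ^+ 2 / e ^+ 3 by rewrite divr_ge0 // exprn_ge0 // ltW.
exists (300 + Num.bound ((200 ^+ 2 / e ^+ 3) ^+ 2))%N => d i d_ge.
set s : R := Num.sqrt d.+1%:R.
have s0 : 0 < s by rewrite sqrtr_gt0 ltr0n.
have s_ge : 200 ^+ 2 / e ^+ 3 <= s.
  rewrite -[leLHS](ger0_norm b0) -sqrtr_sqr ler_wsqrtr //.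
  apply: (le_trans (ltW (archi_boundP (sqr_ge0 _)))).
  by rewrite ler_nat (leq_trans (leq_addl 300 _) (leqW d_ge)).
have d300 : (300 <= d.+1)%N by rewrite (leq_trans (leq_addr _ _) (leqW d_ge)).
have rate := container_rate e0 d300 s_ge; rewrite -/s in rate.
have mu0 : 0 < e / s by rewrite divr_gt0.
have M0 : 0 <= 2 ^+ (2 ^ d) * expR (- (c * 2 ^+ d / s)) :> R.
  by rewrite mulr_ge0 ?expR_ge0 ?exprn_ge0.
have properU : unbalanced rho d.+1 i \subset proper_colourings d.+1.
  by apply/subsetP=> chi; rewrite inE => /andP[].
have := container_count properU _ _ _ M0 rate.
move=> /(_ _ _ _ _)/le_trans; apply.
- by rewrite divn_gt0 // (leq_trans _ d300).
- by rewrite mulnC leq_divM.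
- by lra.
- move=> L termL; apply: (bound d i _ L) => //.
  + exact: subset_trans (subsetIl _ _) properU.
  + exact: subsetIr.
  + by move=> chi; rewrite !inE => /andP[/andP[]].
rewrite -mulrA ler_wpM2l ?exprn_ge0 //.
have E1 : (1 + e / s) ^+ (3 * 2 ^ d.+1) <= expR (c / 2 * 2 ^+ d / s).
  apply: (@le_trans _ _ (expR (e / s) ^+ (3 * 2 ^ d.+1))).
    by rewrite lerXn2r ?nnegrE ?expR_ge0 ?expR_ge1Dx // addr_ge0 // ltW.
  rewrite -expRM_natl ler_expR natrM natrX exprS /e.
  by move: (2 ^+ d) s^-1 => n r; clear; lra.
apply: (le_trans (ler_wpM2l (expR_ge0 _) E1)); rewrite -expRD ler_expR.
by move: (2 ^+ d) s^-1 => n r; clear; lra.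
Qed.

(** * The probability bound in large and in small dimensions *)

(** If [rho >= 1/2] then 1 - rho <= 1/2, so the second term of the entropy alone is at least 1 -
    rho. *)
Lemma entropy_half (R : realType) (rho : R) :
  0 <= rho <= 1 -> bin_entropy rho + rho < 1 -> rho < 1 / 2.
Proof.
move=> /andP[r0 r1]; apply: contraTT; rewrite -!leNgt => rh.
have l2 : 0 < ln 2 :> R by rewrite ln_gt0 // ltr1n.
have H1 : rho * log2 rho <= 0.
  by rewrite mulr_ge0_le0 // /log2 pmulr_lle0 ?invr_gt0 // ln_le0.
have H2 : (1 - rho) * log2 (1 - rho) <= - (1 - rho).
  have [->|rn1] := eqVneq rho 1; first by rewrite subrr mul0r oppr0.
  have r2 : 0 < 1 - rho by rewrite subr_gt0 lt_neqAle rn1.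
  rewrite -mulrN1 ler_wpM2l ?(ltW r2) // /log2 ler_pdivrMr // mulN1r.
  rewrite -lnV ?posrE // ler_ln ?posrE ?invr_gt0 //; lra.
rewrite /bin_entropy; lra.
Qed.

Definition some_unbalanced (R : realType) (rho : R) d (chi : colouring d) :=
  [exists i : 'I_3,
     `| proportion (colour_class chi i) (evens d)
        - proportion (colour_class chi i) (odds d) | <= rho].

Lemma unif_prob_large (R : realType) (rho : R) :
  0 <= rho < 1 / 2 -> exists2 c : R, 0 < c & exists d0 : nat,
  forall d, (d0 <= d)%N ->
  unif_prob (proper_colourings d.+1) (@some_unbalanced R rho d.+1) <=
    expR (- (c * 2 ^+ d / Num.sqrt d.+1%:R)).
Proof.
move=> rho01; have [c c0 [d0 bound]] := unbalanced_bound rho01.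
exists (c / 2); first by rewrite divr_gt0.
(* From there on s >= 4/c, so half of the exponent is at least c s / 2 >= 2, and its exponential
   absorbs the factor 3 of the union bound over colours. *)
pose K := (4 / c) ^+ 2; exists (d0 + Num.bound K)%N => d d_ge.
set s : R := Num.sqrt d.+1%:R.
have s0 : 0 < s by rewrite sqrtr_gt0 ltr0n.
have c4 : 0 <= 4 / c by rewrite divr_ge0 // ltW.
have s_ge : 4 / c <= s.
  rewrite -[leLHS](ger0_norm c4) -sqrtr_sqr ler_wsqrtr //.
  apply: (le_trans (ltW (archi_boundP (sqr_ge0 _)))).
  by rewrite ler_nat (leq_trans (leq_addl d0 _) (leqW d_ge)).
have n_ge : s <= 2 ^+ d / s.
  rewrite ler_pdivlMr // -expr2 sqr_sqrtr // -natrX ler_nat.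
  exact: ltn_expl.
have n0 : 0 < 2 ^+ (2 ^ d) :> R by rewrite exprn_gt0.
have cards : #|[set chi | some_unbalanced rho chi] :&: proper_colourings d.+1|%:R
    <= 3 * (2 ^+ (2 ^ d) * expR (- (c * 2 ^+ d / s))) :> R.
  apply: (@le_trans _ _ (\sum_(i : 'I_3) #|unbalanced rho d.+1 i|%:R)).
    rewrite -natr_sum ler_nat -sum1_card.
    under [leqRHS]eq_bigr => i _ do rewrite -sum1_card big_mkcond.
    rewrite [leqRHS]exchange_big big_mkcond /=; apply: leq_sum => chi _.
    rewrite !inE; case: ifP => // /andP[/existsP[i chii] properchi].
    by rewrite (bigD1 i) //= !inE properchi chii.
  apply: (@le_trans _ _ (\sum_(i : 'I_3) 2 ^+ (2 ^ d) * expR (- (c * 2 ^+ d / s)))).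
    apply: ler_sum => i _; apply: bound; exact: leq_trans (leq_addr _ _) d_ge.
  by rewrite sumr_const card_ord [leRHS]mulr_natl.
have total : 2 ^+ (2 ^ d) <= #|proper_colourings d.+1|%:R :> R.
  by rewrite -natrX ler_nat card_proper_ge.
rewrite /unif_prob /proportion ler_pdivrMr; last exact: lt_le_trans total.
apply: (le_trans cards); apply: (@le_trans _ _ (2 ^+ (2 ^ d) *
    expR (- (c / 2 * 2 ^+ d / s)))); last first.
  by rewrite mulrC ler_wpM2l ?expR_ge0.
rewrite mulrCA ler_wpM2l ?(ltW n0) //.
have -> : - (c / 2 * 2 ^+ d / s) = c / 2 * 2 ^+ d / s + - (c * 2 ^+ d / s).
  by move: (2 ^+ d) s^-1 => n r; clear; lra.
rewrite expRD ler_wpM2r ?expR_ge0 //.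
apply: (le_trans _ (expR_ge1Dx _)).
have H : c / 2 * (4 / c) <= c / 2 * (2 ^+ d / s).
  by rewrite ler_wpM2l ?divr_ge0 ?(ltW c0) // (le_trans s_ge n_ge).
rewrite -mulrA; apply: le_trans (lerD (lexx 1) H).
have -> : c / 2 * (4 / c) = 2 by field; rewrite gt_eqF.
by lra.
Qed.

(** One colouring outside the event suffices, among at most 3^(2^d). This covers the finitely many
    dimensions below the asymptotic range. *)
Lemma unif_prob_small (R : realType) (rho : R) d :
  rho < 1 / 2 -> (2 <= d)%N ->
  unif_prob (proper_colourings d) (@some_unbalanced R rho d) <=
    1 - (3 ^+ (2 ^ d))^-1 :> R.
Proof.
move=> rho1; case: d => [|[|d]] // _; have [chi properchi chib] := exists_biased d rho1.
have P0 : (0 < #|proper_colourings d.+2|)%N by apply/card_gt0P; exists chi.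
have lt : (#|[set chi | some_unbalanced rho chi] :&: proper_colourings d.+2|
    < #|proper_colourings d.+2|)%N.
  apply: proper_card; apply/properP; split; first exact: subsetIr.
  exists chi => //; rewrite !inE; apply/negP=> /andP[/existsP[i chii] _].
  by have := chib i; rewrite inE properchi chii.
have le3 : (#|proper_colourings d.+2| <= 3 ^ 2 ^ d.+2)%N.
  by rewrite (leq_trans (max_card _)) // card_ffun card_ord card_cube.
rewrite /unif_prob /proportion ler_pdivrMr ?ltr0n // mulrBl mul1r.
rewrite lerBrDl -lerBrDr.
have H : #|[set chi | some_unbalanced rho chi] :&: proper_colourings d.+2|%:R + 1
    <= #|proper_colourings d.+2|%:R :> R by rewrite natr1 ler_nat.
have H2 : (3 ^+ (2 ^ d.+2))^-1 * #|proper_colourings d.+2|%:R <= 1 :> R.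
  by rewrite mulrC ler_pdivrMr ?exprn_gt0 // mul1r -natrX ler_nat.
lra.
Qed.

Theorem corollary1p9 (R : realType) (rho : R)
  (rho01 : 0 <= rho <= 1) (Hrho : bin_entropy rho + rho < 1) :
  exists C : R, 0 < C /\
    forall d : nat, (2 <= d)%N ->
      unif_prob (proper_colourings d)
        (fun chi => [exists i : 'I_3,
           `| proportion (colour_class chi i) (evens d)
              - proportion (colour_class chi i) (odds d) | <= rho])
      <= exp2 (- (C * 2 ^+ d / (Num.sqrt d%:R * log2 d%:R))).
Proof.
have rho1 := entropy_half rho01 Hrho; have /andP[rho0 _] := rho01.
have [c c0 [d0 large]] := @unif_prob_large R rho ltac:(by rewrite rho0 rho1).
have l20 : 0 < ln 2 :> R by rewrite ln_gt0 // ltr1n.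
have l21 : ln 2 <= 1 :> R.
  by have := @le_ln1Dx R 1; rewrite -[1 + 1]/2; apply; lra.
(* For [d <= d0] this makes C 2^d at most 3^-(2^d0), hence at most the gap 3^-(2^d) of
   [unif_prob_small]; then 1 - x <= exp(-x). *)
pose c' : R := (3 ^+ (2 ^ d0) * 2 ^+ d0)^-1.
have c'0 : 0 < c' by rewrite invr_gt0 mulr_gt0 ?exprn_gt0.
(* Half of [c], because [large] involves 2^(d-1). *)
exists (Num.min (c / 2) c'); split; first by rewrite lt_min c'0 divr_gt0.
set C := Num.min _ _ => d d_ge2.
have C0 : 0 < C by rewrite lt_min c'0 divr_gt0.
have C1 : C <= c / 2 by rewrite ge_min lexx.
have C2 : C <= c' by rewrite ge_min lexx orbT.
set s : R := Num.sqrt d%:R.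
have s1 : 1 <= s by rewrite -[leLHS]sqrtr1 ler_wsqrtr // ler1n (ltnW d_ge2).
have log1 : 1 <= log2 d%:R :> R.
  by rewrite /log2 ler_pdivlMr // mul1r ler_ln ?posrE ?ltr0n ?ler_nat // (ltnW d_ge2).
have s0 : 0 < s := lt_le_trans ltr01 s1.
have log0 : 0 < log2 d%:R :> R := lt_le_trans ltr01 log1.
have n0 : 0 < 2 ^+ d :> R by rewrite exprn_gt0.
(* As log d >= 1 and ln 2 <= 1, it is enough to prove the stronger bound exp(- C 2^d / s). *)
have E : C * 2 ^+ d / (s * log2 d%:R) <= C * 2 ^+ d / s.
  rewrite ler_wpM2l ?mulr_ge0 ?(ltW C0) ?(ltW n0) // lef_pV2 ?posrE ?(mulr_gt0 s0 log0) //.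
  by rewrite ler_peMr // (ltW s0).
have -> : exp2 (- (C * 2 ^+ d / (s * log2 d%:R))) =
    expR (- (C * 2 ^+ d / (s * log2 d%:R)) * ln 2).
  by rewrite /exp2 /powR pnatr_eq0.
apply: (@le_trans _ _ (expR (- (C * 2 ^+ d / s)))); last first.
  rewrite ler_expR mulNr lerN2; apply: le_trans E; rewrite ler_piMr //.
  by rewrite divr_ge0 ?(ltW (mulr_gt0 C0 n0)) ?(ltW (mulr_gt0 s0 log0)).
case: (ltnP d0 d) => [ltd|led].
  have dE : d.-1.+1 = d by rewrite prednK // ltnW.
  have nE : 2 ^+ d = 2 * 2 ^+ d.-1 :> R by rewrite -exprS dE.
  have := large d.-1; rewrite dE -/s -ltnS dE => /(_ ltd)/le_trans; apply.
  rewrite ler_expR lerN2 ler_wpM2r ?invr_ge0 ?(ltW s0) // nE.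
  have := ler_wpM2r (exprn_ge0 d.-1 (ler0n R 2)) C1; lra.
apply: (le_trans (unif_prob_small rho1 d_ge2)).
apply: le_trans (expR_ge1Dx _); rewrite lerD2l lerN2.
apply: (@le_trans _ _ (C * 2 ^+ d)).
  by rewrite ler_pdivrMr // ler_peMr // mulr_ge0 ?(ltW C0) ?(ltW n0).
apply: (@le_trans _ _ (c' * 2 ^+ d0)).
  by rewrite ler_pM ?(ltW C0) ?(ltW n0) // ler_weXn2l // ler1n.
rewrite /c' invfM -mulrA mulVf ?mulr1 ?expf_neq0 ?pnatr_eq0 //.
rewrite lef_pV2 ?posrE ?exprn_gt0 // ler_weXn2l ?ler1n //.
by rewrite leq_pexp2l.
Qed.
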